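(* Let $l$ be a prime number, let $\mathcal{T}_l\cong\prod_{k\in\mathbb{N}}\mathbb{Z}/l^k\mathbb{Z}$ (a pro-$l$ abelian group), and let $A$ be a finite abelian $l$-group. Then there exists a unique (up to isomorphism of topological groups) pro-$l$ abelian group $\mathcal{D}$ such that: (1) there is an exact sequence of pro-$l$ abelian groups (with continuous homomorphisms) $0\to\mathcal{T}_l\to\mathcal{D}\to A\to 0$; and (2) the topological closure of the torsion subgroup of $\mathcal{D}$ equals (the image of) $\mathcal{T}_l$. *)

(* Defs.v *)
From HB Require Import structures.
From mathcomp Require Import all_boot all_order all_algebra.
From mathcomp Require Import all_classical all_reals.
From mathcomp Require Import topology_structure separation_axioms compact connected.
From mathcomp Require Import discrete_topology function_spaces tvs.
Set Implicit Arguments. Unset Strict Implicit. Unset Printing Implicit Defensive.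
Import GRing.Theory.
Local Open Scope ring_scope.
Local Open Scope classical_set_scope.

(** Z / l^k Z, represented as the ordinals below l^k (note (l^k).-1.+1 = l^k
    since l^k >= 1 for a prime l), with its canonical ring structure (zmodp). *)
Definition Zl (l k : nat) := 'I_(l ^ k).-1.+1.

Definition Tl (l : nat) := prod_topology (fun k => discrete_topology (Zl l k)).

Section TlZmod.
Variable l : nat.
HB.instance Definition _ := Topological.on (Tl l).
Definition Tl_zero : Tl l := fun k => (0 : Zl l k).
Definition Tl_opp (f : Tl l) : Tl l := fun k => - (f k : Zl l k).
Definition Tl_add (f g : Tl l) : Tl l := fun k => (f k : Zl l k) + g k.
Lemma Tl_addA : associative Tl_add.
Proof. by move=> f g h; apply: functional_extensionality_dep => k; exact: addrA. Qed.
Lemma Tl_addC : commutative Tl_add.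
Proof. by move=> f g; apply: functional_extensionality_dep => k; exact: addrC. Qed.
Lemma Tl_add0 : left_id Tl_zero Tl_add.
Proof. by move=> f; apply: functional_extensionality_dep => k; exact: add0r. Qed.
Lemma Tl_addN : left_inverse Tl_zero Tl_opp Tl_add.
Proof. by move=> f; apply: functional_extensionality_dep => k; exact: addNr. Qed.
HB.instance Definition _ :=
  GRing.isZmodule.Build (Tl l) Tl_addA Tl_addC Tl_add0 Tl_addN.
End TlZmod.

Definition open_subgroup (G : topologicalZmodType) (U : set G) :=
  [/\ open U, U 0 & forall x y, U x -> U y -> U (x - y)].

Definition cosets (G : topologicalZmodType) (U : set G) : set (set G) :=
  [set [set y | U (y - x)] | x in [set: G]].

Definition pro_l_abelian (l : nat) (G : topologicalZmodType) :=
  [/\ hausdorff_space G, compact [set: G], totally_disconnected [set: G] &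
      forall U : set G, open_subgroup U ->
        exists n : nat, (cosets U #= `I_(l ^ n)%N)%card].

Definition torsion (G : zmodType) : set G :=
  [set x | exists n : nat, (0 < n)%N /\ x *+ n = 0].

Definition good_extension (l : nat) (A : finZmodType) (D : topologicalZmodType) :=
  exists (i : Tl l -> D) (p : D -> A),
    [/\ zmod_morphism i, continuous i & injective i] /\
    [/\ zmod_morphism p, continuous (p : D -> discrete_topology A) &
        (forall a : A, exists x : D, p x = a)] /\
    range i = [set x | p x = 0] /\
    closure (@torsion D) = range i.

Definition topgroup_isomorphic (G H : topologicalZmodType) :=
  exists (f : G -> H) (g : H -> G),
    [/\ zmod_morphism f, cancel f g, cancel g f, continuous f & continuous g].

(* Main.v *)
Require Import Defs.
From HB Require Import structures.
From mathcomp Require Import all_boot all_order all_algebra.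
From mathcomp Require Import fingroup gproduct cyclic abelian.
From mathcomp Require Import finmap all_classical all_reals.
From mathcomp Require Import topology_structure separation_axioms compact connected.
From mathcomp Require Import discrete_topology function_spaces tvs.
From mathcomp Require Import supremum_topology product_topology.
From mathcomp Require Import subspace_topology zify.
Set Implicit Arguments. Unset Strict Implicit. Unset Printing Implicit Defensive.
Import GRing.Theory.
Local Open Scope ring_scope.
Local Open Scope classical_set_scope.

(** Write A as a direct sum of cyclic groups <g_j> of order l^(e_j).  An
    extension D of A by T = Tl l is generated by T and lifts d_j of the g_j, so
    it is determined by the elements t_j = l^(e_j) d_j of T.  The torsion of D
    lies in T if and only if the vectors (t_j k mod l)_j in F_l^r, k >= n, span
    F_l^r for every n; one such family gives existence.

    For uniqueness, any two such families t, t' are exchanged by an automorphism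
    of T.  Split the coordinates into a set S and its complement in such a way
    that t still spans cofinally on S, and t' on the complement.  Since Z/l^k'
    maps onto Z/l^k for k <= k', adding to each coordinate outside S a
    combination of later coordinates in S turns t into a family that agrees with
    t' outside S; adding then to each coordinate in S a combination of later
    coordinates outside S produces t'. *)

(** * Bases of finite abelian groups *)

(** Induction on [b]. In a vanishing sum the head term lies both in the first cycle and in the
    product [H] of the others; these meet trivially, so both parts vanish. *)
Lemma dprod_cycles_coordinates (A : finZmodType) (b : seq A) (G : {group A}) :
  (\big[dprod/1]_(x <- b) <[x]>)%g = G ->
  (forall a, a \in G ->
    exists n : nat -> nat, a = \sum_(j < size b) b`_j *+ n j) /\
  (forall n : nat -> nat, \sum_(j < size b) b`_j *+ n j = 0 ->
    forall j, (j < size b)%N -> (#[b`_j]%g %| n j)%N).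
Proof.
elim: b G => [|x b IH] G; rewrite ?big_nil ?big_cons.
  move=> <-; split=> [a /set1gP ->|//].
  by exists (fun=> 0%N); rewrite big_ord0.
case/dprodP=> -[_ H _ defH] defG _ tiH; rewrite defH in defG tiH.
have [genH indH] := IH H defH; split=> [a|n].
  rewrite -defG => /mulsgP[_ h /cycleP[m ->] /genH[n ->] ->].
  exists (fun j => if j is j'.+1 then n j' else m).
  by rewrite big_ord_recl.
rewrite big_ord_recl /= => sum0.
pose h := \sum_(j < size b) b`_j *+ n j.+1.
have hH : h \in H.
  rewrite /h; elim/big_ind: _ => [|u v uH vH|j _].
  - exact: (group1 H).
  - exact: (groupM uH vH).
  - apply: (@groupX _ H).
    have /bigdprodWY <- := defH.
    rewrite mem_gen //; rewrite (big_nth 0) big_mkord.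
    by apply/bigcupP; exists j => //; exact: cycle_id.
have xH : (x ^+ n 0)%g \in H.
  rewrite -(mulgK (h : A) (x ^+ n 0)%g) groupM ?groupV //.
  by have -> : (x ^+ n 0 * h)%g = 1%g by []; exact: group1.
have x1 : (x ^+ n 0)%g = 1%g.
  by apply/set1P; rewrite -set1gE -tiH inE mem_cycle.
have h0 : h = 0 by move: sum0; rewrite [x *+ n 0]x1 add0r.
case=> [_|j]; first by rewrite order_dvdn x1.
exact: (indH (fun j => n j.+1) h0 j).
Qed.

Lemma abelian_group_coordinates (l : nat) (A : finZmodType) :
  prime l -> l.-nat #|A| ->
  exists (r : nat) (e : 'I_r -> nat) (g : 'I_r -> A),
    [/\ forall j, (0 < e j)%N,
        forall j, g j *+ l ^ e j = 0,
        forall a, exists n : 'I_r -> nat, a = \sum_j g j *+ n j &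
        forall n : 'I_r -> nat, \sum_j g j *+ n j = 0 ->
          forall j, (l ^ e j %| n j)%N].
Proof.
move=> lP lA.
have [b defA ord_b] := abelian_structure (FinRing.zmod_abelian [set: A]).
have [genA indA] := dprod_cycles_coordinates defA.
have ordX (j : 'I_(size b)) : (1 < #[b`_j]%g)%N.
  apply: (allP (abelian_type_gt1 [set: A])).
  by rewrite -ord_b map_f // mem_nth.
have ordE (j : 'I_(size b)) : #[b`_j]%g = (l ^ logn l #[b`_j]%g)%N.
  rewrite -p_part part_pnat_id //; apply: pnat_dvd lA.
  by rewrite -cardsT; apply: order_dvdG; rewrite inE.
exists (size b), (fun j => logn l #[b`_j]%g), (fun j => b`_j); split.
- move=> j; rewrite lt0n; apply: contraTN (ordX j) => /eqP e0.
  by rewrite ordE e0.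
- by move=> j; rewrite -ordE; exact: expg_order.
- move=> a; have [n ->] := genA a (finset.in_setT a).
  by exists (fun j => n j).
- move=> n sum0 j; rewrite -ordE.
  have := indA (fun k => if insub k is Some i then n i else 0%N) _ j
    (ltn_ord j).
  rewrite /= valK; apply; rewrite -[RHS]sum0.
  by apply: eq_bigr => i _; rewrite valK.
Qed.

(** * Coordinates of the product of the cyclic groups *)

(** As the factors are discrete, the sets [agree K x] form a base of neighbourhoods of [x]. *)
Definition agree (l K : nat) (x y : Tl l) := forall k, (k < K)%N -> y k = x k.

Lemma nbhs_TlP (l : nat) (x : Tl l) (U : set (Tl l)) :
  nbhs x U <-> exists K, forall y, agree K x y -> U y.
Proof.
split=> [xU|[K xKU]].
  (* Otherwise points outside [U] that agree with [x] below [K], one for each [K], form a sequence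
     converging to [x], which must enter [U]. *)
  apply: contrapT => noK.
  have /choice[y yP] : forall K, exists y, agree K x y /\ ~ U y.
    move=> K; apply: contrapT => noy; apply: noK; exists K => y xy.
    by apply: contrapT => nUy; apply: noy; exists y.
  have ycvg : y @ \oo --> x.
    apply/cvg_sup => k V [W] [[B] oB <-] Bxk WV.
    apply: (filterS WV); rewrite nbhs_simpl; exists k.+1 => // n /= kn.
    by have [-> //] := yP n.
  have [n _ /(_ n)] := ycvg _ xU.
  by rewrite /= leqnn => /(_ isT) Un; have [_] := yP n.
have prefix_nbhs : nbhs x [set y | agree K x y].
  elim: K {xKU} => [|K IH]; first by apply: filterS filterT => y _ k.
  have xK : nbhs x [set y : Tl l | y K = x K].
    apply: (@proj_continuous _ (fun k => discrete_topology (Zl l k)) K x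
      [set x K]).
    exact: discrete_set1.
  apply: filterS (filterI IH xK) => y [yx yK] k.
  by rewrite ltnS leq_eqVlt => /orP[/eqP ->|/yx].
by apply: filterS prefix_nbhs => y; exact: xKU.
Qed.

Lemma Tl_continuousP (l l' : nat) (f : Tl l -> Tl l') :
  continuous f <->
  forall x K, exists K', forall y, agree K' x y -> agree K (f x) (f y).
Proof.
split=> [fc x K|H x U /nbhs_TlP[K KU]].
  by apply/nbhs_TlP; apply: fc; apply/nbhs_TlP; exists K.
have [K' H'] := H x K; apply/nbhs_TlP.
by exists K' => y /H' /KU.
Qed.

Lemma TlD (l : nat) (x y : Tl l) k : (x + y) k = (x k : Zl l k) + y k.
Proof. by []. Qed.
Lemma TlN (l : nat) (x : Tl l) k : (- x) k = - (x k : Zl l k).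
Proof. by []. Qed.
Lemma Tl0 (l : nat) k : (0 : Tl l) k = 0 :> Zl l k.
Proof. by []. Qed.
Lemma TlMn (l : nat) (x : Tl l) n k : (x *+ n) k = (x k : Zl l k) *+ n.
Proof. by elim: n => [|n IH] //; rewrite !mulrS TlD IH. Qed.
Lemma Tl_sum (l : nat) (I : Type) (s : seq I) (P : pred I) (F : I -> Tl l) k :
  (\sum_(i <- s | P i) F i) k = \sum_(i <- s | P i) (F i k : Zl l k).
Proof. by apply: (big_morph (fun x : Tl l => x k : Zl l k)). Qed.

(** * Residues modulo powers of [l], spanning windows and shears *)

Section Residues.
Variables (l : nat) (lP : prime l).

Let lX0 k : (l ^ k).-1.+1 = (l ^ k)%N.
Proof. by rewrite prednK // expn_gt0 prime_gt0. Qed.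

Definition res (k k' : nat) (x : Zl l k') : Zl l k := inZp x.

Lemma val_Zl n k : val (inZp n : Zl l k) = (n %% l ^ k)%N.
Proof. by rewrite -[X in (_ %% X)%N]lX0. Qed.

Lemma Zl_valD k (x y : Zl l k) : val (x + y) = ((x + y)%N %% l ^ k)%N.
Proof. by rewrite -[X in (_ %% X)%N]lX0. Qed.

Lemma Zl_valMn k (x : Zl l k) n : val (x *+ n) = (x * n %% l ^ k)%N.
Proof. by rewrite Zp_mulrn -[X in (_ %% X)%N]lX0. Qed.

Lemma Zl_lt k (x : Zl l k) : (x < l ^ k)%N.
Proof. by rewrite -[X in (_ < X)%N]lX0 ltn_ord. Qed.

Lemma resD k k' (x y : Zl l k') : (k <= k')%N ->
  res k (x + y) = res k x + res k y.
Proof.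
move=> kk'; apply: val_inj; rewrite Zl_valD !val_Zl Zl_valD modnDm.
by rewrite modn_dvdm // dvdn_exp2l.
Qed.

Lemma res0 k k' : res k (0 : Zl l k') = 0.
Proof. by apply: val_inj; rewrite val_Zl mod0n. Qed.

Lemma Zl_char k (x : Zl l k) : x *+ l ^ k = 0.
Proof. by apply: val_inj; rewrite Zl_valMn modnMl. Qed.

Definition red k (x : Zl l k) : 'F_l := (x : nat)%:R.

Lemma red_mod k n : (0 < k)%N -> ((n %% l ^ k)%N)%:R = n%:R :> 'F_l.
Proof.
move=> k0; rewrite {2}(divn_eq n (l ^ k)) natrD natrM natrX pchar_Fp_0 //.
by rewrite expr0n eqn0Ngt k0 mulr0 add0r.
Qed.

Lemma redD k (x y : Zl l k) : (0 < k)%N -> red (x + y) = red x + red y.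
Proof. by move=> k0; rewrite /red Zl_valD red_mod // natrD. Qed.

Lemma redN k (x : Zl l k) : (0 < k)%N -> red (- x) = - red x.
Proof.
by move=> k0; apply/eqP; rewrite -subr_eq0 opprK -redD // addNr.
Qed.

Lemma redMn k (x : Zl l k) n : (0 < k)%N -> red (x *+ n) = red x *+ n.
Proof.
by move=> k0; rewrite /red Zl_valMn red_mod // natrM mulr_natr.
Qed.

Lemma red_sum k (I : Type) (s : seq I) (P : pred I) (F : I -> Zl l k) :
  (0 < k)%N -> red (\sum_(i <- s | P i) F i) = \sum_(i <- s | P i) red (F i).
Proof.
by move=> k0; apply: (big_morph (@red k)) => // x y; exact: redD.
Qed.

Lemma red_res k k' (x : Zl l k') : (0 < k)%N -> red (res k x) = red x.
Proof. by move=> k0; rewrite /red val_Zl red_mod. Qed.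

Lemma red_eq0 k (x : Zl l k) : red x = 0 -> exists y : Zl l k, x = y *+ l.
Proof.
move/eqP; rewrite -(dvdn_pcharf (pchar_Fp lP)) => /dvdnP[q xq].
exists (inZp q); apply: val_inj.
by rewrite Zl_valMn val_Zl modnMml -xq modn_small ?Zl_lt.
Qed.

(** The rows are the vectors [(t_j k mod l)_j] for [a <= k < a + n]; full rank says that they span
    F_l^r. *)
Definition spans r (t : 'I_r -> Tl l) (a n : nat) :=
  row_full (\matrix_(i < n, j < r) red (t j (a + i)%N)).

(* Nakayama: spanning modulo l implies spanning modulo l^k. *)
Lemma spans_lift r (t : 'I_r -> Tl l) a n k (y : 'I_r -> Zl l k) :
  (k <= a)%N -> spans t a n ->
  exists w : 'I_n -> nat,
    forall j, y j = \sum_(i < n) res k (t j (a + i)%N) *+ w i.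
Proof.
move=> ka /row_fullP[B BM].
have [k0|k0] := posnP k.
  exists (fun=> 0%N) => j; apply: val_inj; subst k.
  move: (ltn_ord (y j)) (ltn_ord (\sum_(i < n) res 0 (t j (a + i)%N) *+ 0)).
  by move=> /=; case: (y j : nat) => // _; case: (X in (X < 1)%N -> _).
(* Successive approximation: [z j *+ l ^ m] is the error after [m] rounds, and it vanishes at
   [m = k]. *)
suff main m : exists (w : 'I_n -> nat) (z : 'I_r -> Zl l k),
    forall j, y j = \sum_(i < n) res k (t j (a + i)%N) *+ w i + z j *+ l ^ m.
  have [w [z wz]] := main k; exists w => j.
  by rewrite wz Zl_char addr0.
elim: m => [|m [w [z wz]]].
  by exists (fun=> 0%N), y => j; rewrite big1 ?add0r.
have [c cM] : exists c : 'rV_n,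
    forall j, red (z j) = \sum_(i < n) c 0 i * red (t j (a + i)%N).
  exists (\row_j red (z j) *m B) => j.
  have /(congr1 (fun v : 'rV_r => v 0 j)) : \row_j red (z j) *m B *m
      \matrix_(i < n, j < r) red (t j (a + i)%N) = \row_j red (z j).
    by rewrite -mulmxA BM mulmx1.
  rewrite mxE [X in _ = X]mxE => <-; apply: eq_bigr => i _.
  by congr (_ * _); rewrite mxE.
have /choice[z' zz'] j : exists z' : Zl l k,
    z j - \sum_(i < n) res k (t j (a + i)%N) *+ (c 0 i : nat) = z' *+ l.
  apply: red_eq0; rewrite redD // redN // red_sum //.
  rewrite cM; apply/eqP; rewrite subr_eq0; apply/eqP/eq_bigr => i _.
  by rewrite redMn // red_res // -mulr_natr natr_Zp mulrC.
exists (fun i => w i + c ord0 i * l ^ m)%N, z' => j.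
rewrite wz expnS mulrnA -zz' [in RHS](eq_bigr (fun i : 'I_n =>
    res k (t j (a + i)%N) *+ w i +
    res k (t j (a + i)%N) *+ c ord0 i *+ l ^ m)); last first.
  by move=> i _; rewrite mulrnDr mulrnA.
rewrite big_split /= mulrnBl -sumrMnl -[RHS]addrA.
by rewrite [X in _ = _ + X]addrC subrK.
Qed.

Definition spans_often r (t : 'I_r -> Tl l) (S : nat -> Prop) :=
  forall k, exists a n,
    [/\ (k < a)%N, spans t a n & forall i, (i < n)%N -> S (a + i)%N].

(* The automorphism is 1 + N where N reads the coordinates in S and writes those
   outside S, so that N^2 = 0 and 1 - N is its inverse. *)
Lemma exists_shear r (t t' : 'I_r -> Tl l) (S : nat -> Prop) :
  spans_often t S ->
  exists f g : Tl l -> Tl l,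
    [/\ {morph f : x y / x + y}, continuous f, cancel f g, cancel g f &
        forall j k,
          (S k -> f (t j) k = t j k) /\ (~ S k -> f (t j) k = t' j k)].
Proof.
move=> tS.
(* Outside [S], the difference [t' - t] at [k] is a combination of later coordinates in [S]; inside
   [S], the empty window [n = 0] makes [N] vanish. *)
have coeff k : exists (a n : nat) (w : nat -> nat),
    [/\ (k < a)%N, forall i, (i < n)%N -> S (a + i)%N, S k -> n = 0%N &
      ~ S k -> forall j, (t' j k : Zl l k) - t j k =
        \sum_(i < n) res k (t j (a + i)%N) *+ w i].
  have [Sk|nSk] := pselect (S k).
    by exists k.+1, 0%N, (fun=> 0%N).
  have [a [n [ka tan San]]] := tS k.
  have [w wE] := spans_lift (fun j => (t' j k : Zl l k) - t j k) (ltnW ka) tan.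
  exists a, n, (fun i => if insub i is Some i' then w i' else 0%N).
  split=> // _ j.
  by rewrite wE; apply: eq_bigr => i _; rewrite valK.
move: coeff => /choice[a] /choice[n] /choice[w awn].
pose N (x : Tl l) : Tl l :=
  fun k => \sum_(i < n k) res k (x (a k + i)%N) *+ w k i.
have ND : {morph N : x y / x + y}.
  move=> x y; apply: functional_extensionality_dep => k.
  rewrite TlD /N -big_split; apply: eq_bigr => i _ /=.
  have [ka _ _ _] := awn k.
  by rewrite TlD resD ?mulrnDl // (leq_trans (ltnW ka)) ?leq_addr.
(* [N] reads only coordinates in [S], where [N x] is an empty sum. *)
have NN x : N (N x) = 0.
  apply: functional_extensionality_dep => k.
  rewrite [LHS]/N big1 // => i _; have [_ Sa _ _] := awn k.
  have [_ _ n0 _] := awn (a k + i)%N.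
  rewrite [N x _]/N; move: (Sa i (ltn_ord i)) => /n0.
  case: (n _) => // _; rewrite big_ord0 res0.
  by elim: (w k i) => // m IH; rewrite mulrS IH addr0.
have N0 : N 0 = 0 by apply: (@addrI _ (N 0)); rewrite -ND !addr0.
have NNeg x : N (- x) = - N x.
  by apply/eqP; rewrite -addr_eq0 -ND addNr N0.
exists (fun x => x + N x), (fun x => x - N x); split.
- by move=> x y; rewrite ND addrACA.
- apply/Tl_continuousP => x K.
  (* Coordinate [k] of [N x] reads only positions below [a k + n k]; the sum bounds these for all
     [k < K] at once. *)
  exists (K + \sum_(k < K) (a k + n k))%N => y xy k kK.
  rewrite !TlD (xy k) ?(leq_trans kK) ?leq_addr //; congr (_ + _).
  apply: eq_bigr => i _; rewrite xy //.
  rewrite (bigD1 (Ordinal kK)) //=.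
  by have := ltn_ord i; lia.
- by move=> x; rewrite ND NN addr0 addrK.
- by move=> x; rewrite ND NNeg NN subr0 subrK.
- move=> j k; rewrite TlD; have [_ _ nS wS] := awn k.
  split=> [/nS n0|/wS/(_ j) tt'].
    by rewrite /N n0 big_ord0 addr0.
  by rewrite -[N _ k]tt' addrC subrK.
Qed.

End Residues.

(** * Automorphisms of the product *)

(** Iterating [f] from 0 cuts the integers into consecutive windows [[K n, K n.+1)]; [S] takes the
    even ones and leaves the odd ones to its complement. *)
Lemma alternating_windows (f : nat -> nat) : (forall n, (n < f n)%N) ->
  exists S : nat -> Prop, forall k, exists a b,
    [/\ (k < a)%N, forall i, (a <= i < f a)%N -> S i,
        (k < b)%N & forall i, (b <= i < f b)%N -> ~ S i].
Proof.
move=> fgt; pose K n := iter n f 0%N.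
have Kmono m n : (m <= n)%N -> (K m <= K n)%N.
  move=> /subnK <-; elim: (n - m)%N => // d IH.
  by apply: leq_trans IH _; exact: ltnW (fgt _).
have Kge n : (n <= K n)%N.
  by elim: n => // n IH; apply: leq_ltn_trans IH _; exact: fgt.
exists (fun i => exists n, (K n.*2 <= i < K n.*2.+1)%N) => k.
exists (K k.+1.*2), (K k.+1.*2.+1); split.
- by apply: leq_trans (Kge _); lia.
- by move=> i; exists k.+1.
- by apply: leq_trans (Kge _); lia.
- move=> i /andP[lo hi] [n /andP[lo' hi']].
  have [nk|kn] := leqP n k.+1.
    by have := Kmono n.*2.+1 k.+1.*2.+1; lia.
  have := Kmono k.+1.*2.+2 n.*2.
  by have -> : K k.+1.*2.+2 = f (K k.+1.*2.+1) by []; lia.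
Qed.

Section Automorphism.
Variables (l : nat) (lP : prime l).

(** Dual form of cofinal spanning: no nonzero linear form on F_l^r kills the vectors
    [(t_j k mod l)_j] for all large [k]. *)
Definition independent r (t : 'I_r -> Tl l) :=
  forall c : 'rV['F_l]_r, c != 0 ->
    forall n, exists2 k, (n <= k)%N & \sum_j c 0 j * red (t j k) != 0.

(** There are finitely many linear forms [c]; a window containing, for each nonzero one, a
    coordinate where it does not vanish has full rank. *)
Lemma independent_window r (t : 'I_r -> Tl l) a : independent t ->
  exists n, forall m, (n <= m)%N -> spans t a m.
Proof.
move=> ind.
have /choice[k kP] (c : 'rV['F_l]_r) : exists k, c != 0 ->
    (a <= k)%N /\ \sum_j c 0 j * red (t j k) != 0.
  have [->|c0] := eqVneq c 0; first by exists 0%N.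
  by have [k ak tk] := ind c c0 a; exists k.
exists (\max_c k c).+1 => m km; rewrite /spans /row_full -mxrank_tr.
rewrite -[_ == _]/(row_free _) -kermx_eq0.
apply: contraT => /rowV0Pn[c /sub_kermxP cM c0].
have [ak /negP[]] := kP c c0; apply/eqP.
have km' : (k c - a < m)%N.
  by apply: leq_ltn_trans km; rewrite (leq_trans (leq_subr _ _)) // leq_bigmax.
have := congr1 (fun v : 'rV_m => v 0 (Ordinal km')) cM.
rewrite !mxE; apply: etrans; apply: eq_bigr => j _.
by rewrite !mxE /= subnKC.
Qed.

Lemma spans_eq r (t t' : 'I_r -> Tl l) a n :
  (forall j i, (i < n)%N -> t j (a + i)%N = t' j (a + i)%N) ->
  spans t a n -> spans t' a n.
Proof.
move=> tt'; rewrite /spans; congr (is_true (row_full _)).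
by apply/matrixP => i j; rewrite !mxE tt'.
Qed.

Lemma independent_automorphism r (t t' : 'I_r -> Tl l) :
  independent t -> independent t' ->
  exists f g : Tl l -> Tl l,
    [/\ {morph f : x y / x + y}, continuous f, cancel f g, cancel g f &
        forall j, f (t j) = t' j].
Proof.
move=> indt indt'.
(* [f a] ends a window starting at [a] on which both families span. *)
have /choice[f fP] (a : nat) : exists b,
    [/\ (a < b)%N, spans t a (b - a) & spans t' a (b - a)].
  have [n nP] := independent_window a indt.
  have [n' nP'] := independent_window a indt'.
  exists (a + (n + n').+1)%N; rewrite addKn; split; first by lia.
    by apply: nP; lia.
  by apply: nP'; lia.
have [S SP] : exists S : nat -> Prop, forall k, exists a b,
    [/\ (k < a)%N, forall i, (a <= i < f a)%N -> S i,
        (k < b)%N & forall i, (b <= i < f b)%N -> ~ S i].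
  by apply: alternating_windows => n; have [] := fP n.
have tS : spans_often t S.
  move=> k; have [a [_ [ka aS _ _]]] := SP k; exists a, (f a - a)%N.
  have [_ ta _] := fP a; split=> // i ia; apply: aS; lia.
have [p [q [pD pc pK qK ptE]]] := exists_shear lP t' tS.
have tS' : spans_often (fun j => p (t j)) (fun k => ~ S k).
  move=> k; have [_ [b [_ _ kb bS]]] := SP k; exists b, (f b - b)%N.
  have bS' i : (i < f b - b)%N -> ~ S (b + i)%N by move=> ib; apply: bS; lia.
  have [_ _ tb] := fP b; split=> //; apply: spans_eq tb => j i ib.
  by have [_ ->] := ptE j (b + i)%N; last exact: bS'.
have [p' [q' [p'D p'c p'K q'K p'tE]]] := exists_shear lP t' tS'.
exists (p' \o p), (q \o q'); split.
- by move=> x y /=; rewrite pD p'D.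
- by move=> x; apply: continuous_comp; [exact: pc|exact: p'c].
- exact: can_comp.
- exact: can_comp.
- move=> j; apply: functional_extensionality_dep => k /=.
  have [pS pnS] := ptE j k; have [p'S p'nS] := p'tE j k.
  have [Sk|nSk] := pselect (S k); first by rewrite p'nS.
  by rewrite p'S // pnS.
Qed.

End Automorphism.

(** * Topological extensions defined by factor sets *)

(** Symmetric normalized 2-cocycles for the trivial action; symmetry makes the resulting extension
    abelian. *)
Record factor_set (l : nat) (A : zmodType) := FactorSet {
  fs_fun :> A -> A -> Tl l;
  fs_sym : forall a b, fs_fun a b = fs_fun b a;
  fs0l : forall a, fs_fun 0 a = 0;
  fs_assoc : forall a b c,
    fs_fun b c + fs_fun a (b + c) = fs_fun a b + fs_fun (a + b) c }.

(** The parameter [c] keeps apart the group laws that different cocycles put on the same product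
    space. *)
Definition twisted_sum (l : nat) (A : zmodType) (c : factor_set l A) :=
  (Tl l * discrete_topology A)%type.

Section TwistedSum.
Variables (l : nat) (A : zmodType) (c : factor_set l A).
Local Notation D := (twisted_sum c).

HB.instance Definition _ :=
  Topological.copy D (Tl l * discrete_topology A)%type.

Definition tw_zero : D := (0, 0).
Definition tw_opp (u : D) : D := (- u.1 - c u.2 (- (u.2 : A)), - (u.2 : A)).
Definition tw_add (u v : D) : D := (u.1 + v.1 + c u.2 v.2, (u.2 : A) + v.2).

Lemma tw_addA : associative tw_add.
Proof.
move=> [x a] [y b] [z d]; rewrite /tw_add /=; congr pair; last exact: addrA.
by rewrite -!addrA fs_assoc (addrCA z).
Qed.

Lemma tw_addC : commutative tw_add.
Proof.
by move=> [x a] [y b]; rewrite /tw_add /= (addrC x) fs_sym (addrC (a : A)).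
Qed.

Lemma tw_add0 : left_id tw_zero tw_add.
Proof. by move=> [x a]; rewrite /tw_add /= fs0l addr0 !add0r. Qed.

Lemma tw_addN : left_inverse tw_zero tw_opp tw_add.
Proof.
move=> [x a]; rewrite /tw_add /tw_zero /= addNr fs_sym; congr pair.
by rewrite addrAC subrK addNr.
Qed.

HB.instance Definition _ :=
  GRing.isZmodule.Build D tw_addA tw_addC tw_add0 tw_addN.

Lemma twD (u v : D) : u + v = (u.1 + v.1 + c u.2 v.2, (u.2 : A) + v.2).
Proof. by []. Qed.

Lemma twN (u : D) : - u = (- u.1 - c u.2 (- (u.2 : A)), - (u.2 : A)).
Proof. by []. Qed.

Lemma nbhs_twP (u : D) (U : set D) :
  nbhs u U <-> exists K, forall y, agree K u.1 y -> U (y, u.2).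
Proof.
split=> [[[P Q] /= [/nbhs_TlP[K KP] uQ] PQ]|[K KU]].
  by exists K => y /KP Py; apply: PQ; split => //=; exact: nbhs_singleton uQ.
exists ([set y | agree K u.1 y], [set u.2]) => /=.
  split; last exact: discrete_set1.
  by apply/nbhs_TlP; exists K.
by move=> [y a] /= [/KU Uy ->].
Qed.

Lemma tw_sub_continuous : continuous (fun w : D * D => w.1 - w.2).
Proof.
move=> [u v] U /nbhs_twP[K KU].
exists ([set w : D | agree K u.1 w.1 /\ w.2 = u.2],
        [set w : D | agree K v.1 w.1 /\ w.2 = v.2]) => /=.
  by split; apply/nbhs_twP; exists K.
move=> [[x a] [y b]] /= [[/= xu ->] [/= yv ->]].
by apply: KU => k kK; rewrite /= !(TlD, TlN) xu ?yv.
Qed.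

HB.instance Definition _ :=
  PreTopologicalNmodule_isTopologicalZmodule.Build D tw_sub_continuous.

Lemma finitely_determined_clopen (U : set D) K :
  (forall u y, agree K u.1 y -> U u <-> U (y, u.2)) -> clopen U.
Proof.
move=> UK; split; last rewrite -[U]setCK; last apply: open_closedC;
  rewrite openE => u Uu; apply/nbhs_twP; exists K => y uy;
  have [Uuy Uyu] := UK u y uy; first exact: Uuy.
by move=> /Uyu; apply: Uu.
Qed.

Lemma tw_zero_dimensional : zero_dimensional D.
Proof.
move=> [x a] [y b] xayb.
have [ab|nab] := pselect (a = b).
  have [k xy] : exists k, x k <> y k.
    apply/existsNP => xy; case/eqP: xayb; rewrite ab; congr pair.
    exact: functional_extensionality_dep.
  exists [set u : D | u.1 k = x k]; split => //=; last exact/nesym.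
  by apply: (@finitely_determined_clopen _ k.+1) => u z uz /=; rewrite uz.
exists [set u : D | u.2 = a]; split => //=; last exact/nesym.
exact: (@finitely_determined_clopen _ 0%N).
Qed.

Lemma tw_hausdorff : hausdorff_space D.
Proof.
rewrite open_hausdorff => u v /tw_zero_dimensional[U [[oU cU] Uu Uv]].
exists (U, ~` U); first by split; rewrite inE.
by split=> //=; [exact: closed_openC|rewrite setICr].
Qed.

End TwistedSum.

Lemma finType_compact (F : finType) : compact [set: discrete_topology F].
Proof. by apply: finite_compact; exact: finite_finset. Qed.

Lemma Tl_compact (l : nat) : compact [set: Tl l].
Proof.
have := @tychonoff nat (fun k => discrete_topology (Zl l k)) (fun=> setT)
  (fun k => @finType_compact _).
by congr (compact _); apply/seteqP; split.
Qed.

Lemma tw_compact (l : nat) (A : finZmodType) (c : factor_set l A) :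
  compact [set: twisted_sum c].
Proof.
have := compact_setX (@Tl_compact l) (@finType_compact A).
by rewrite setXTT.
Qed.

(** * Index of open subgroups *)

Lemma open_subgroupD (G : topologicalZmodType) (U : set G) :
  open_subgroup U -> forall x y, U x -> U y -> U (x + y).
Proof.
move=> [_ U0 UB] x y Ux Uy; rewrite -[y]opprK; apply: (UB _ _) => //.
by rewrite -sub0r; apply: UB.
Qed.

Lemma open_subgroupMn (G : topologicalZmodType) (U : set G) :
  open_subgroup U -> forall x n, U x -> U (x *+ n).
Proof.
move=> oU x n Ux; elim: n => [|n IH]; first by case: oU.
by rewrite mulrS; exact: open_subgroupD.
Qed.

Lemma translation_continuous (G : topologicalZmodType) (z : G) :
  continuous (fun y : G => y + z).
Proof.
move=> y; apply: (@continuous_comp _ _ _ (fun y => (y, z))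
  (fun w : G * G => w.1 + w.2)); last exact: add_continuous.
by apply: cvg_pair => /=; [exact: cvg_id|exact: cvg_cst].
Qed.

Lemma open_subgroup_finite_index (G : topologicalZmodType) (U : set G) :
  compact [set: G] -> open_subgroup U ->
  exists s : seq G, forall x, exists i : 'I_(size s), U (x - s`_i).
Proof.
pose pG : ptopologicalType :=
  HB.pack (TopologicalZmodule.sort G) (isPointed.Build G 0).
move=> cG [oU U0 _]; have : @compact pG setT by [].
rewrite compact_cover => cvG.
have [||F _ FG] := cvG G setT (fun x => [set y : pG | U ((y : G) - x)]).
- move=> x _; rewrite openE => y Uyx.
  by apply: (@translation_continuous G (- x)); exact: open_nbhs_nbhs.
- by move=> x _; exists x => //=; rewrite subrr.
exists (enum_fset F) => x; have [y /= yF Uxy] := FG x I.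
have ys : (index y (enum_fset F) < size (enum_fset F))%N by rewrite index_mem.
by exists (Ordinal ys); rewrite /= nth_index.
Qed.

(* G / U is a quotient of the finite l-group B = (Z/l^m)^s, through psi. *)
Lemma open_subgroup_index (l : nat) (G : topologicalZmodType) (U : set G) :
  prime l -> compact [set: G] -> open_subgroup U ->
  (forall x, exists M, U (x *+ l ^ M)) ->
  exists n, (cosets U #= `I_(l ^ n)%N)%card.
Proof.
move=> lP cG oU tor.
have [s sP] := open_subgroup_finite_index cG oU.
have [oU' U0 UB] := oU.
have UN x : U x -> U (- x) by move=> Ux; rewrite -sub0r; exact: UB.
have UD := open_subgroupD oU.
have /choice[M MP] := tor.
(* One exponent for all representatives: [l ^ m] multiplies each of them into [U]. *)
pose m := \sum_(i < size s) M s`_i.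
have Um (i : 'I_(size s)) : U (s`_i *+ l ^ m).
  rewrite /m (bigD1 i) //= expnD mulrnA; exact: open_subgroupMn.
have lm : (l ^ m).-1.+1 = (l ^ m)%N by rewrite prednK // expn_gt0 prime_gt0.
pose B : finZmodType := 'rV['I_(l ^ m).-1.+1]_(size s).
pose psi (b : B) : G := \sum_(i < size s) s`_i *+ b 0 i.
(* [psi] is additive modulo [U]: adding residues drops multiples of [l ^ m], whose contribution lies
   in [U]. *)
have psiD b b' : U (psi (b + b') - (psi b + psi b')).
  rewrite /psi -big_split -sumrB; apply: (big_ind U) => // i _ /=.
  rewrite mxE /= -mulrnDr.
  move: (_ + _)%N => v; rewrite lm {2}(divn_eq v (l ^ m)) mulrnDr.
  rewrite opprD addrCA addrN addr0; apply: UN.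
  by rewrite mulnC mulrnA; exact: open_subgroupMn.
have psi0 : psi 0 = 0.
  by rewrite /psi big1 // => i _; rewrite mxE.
have psiN b : U (psi (- b) + psi b).
  have := psiD b (- b); rewrite addrN psi0 sub0r addrC => /UN.
  by rewrite opprK.
have psiB b b' : U (psi (b - b') - (psi b - psi b')).
  have -> : psi (b - b') - (psi b - psi b') =
    psi (b - b') - (psi b + psi (- b')) + (psi (- b') + psi b').
    by rewrite !opprD opprK !addrA subrK.
  exact: UD.
(* The kernel of the map from [B] to G/U induced by [psi]; its index divides the order of [B], a
   power of [l]. *)
pose K := [set b : B | `[< U (psi b) >]]%SET.
have KP b : reflect (U (psi b)) (b \in K) by rewrite inE; exact: asboolP.
have UE x y : U (x - y) -> U x <-> U y.
  by move=> Uxy; split=> [Ux|Uy]; [rewrite -(subKr x y)|rewrite -(subrK y x)];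
    [exact: UB|exact: UD].
have Kgroup : group_set K.
  apply/group_setP; split; first by apply/KP; rewrite psi0.
  move=> b b' /KP Ub /KP Ub'; apply/KP.
  by apply/(UE _ _ (psiD b b')); exact: UD.
pose KG := Group Kgroup.
have inK b b' : (b * b'^-1)%g \in K <-> U (psi b - psi b').
  split=> [/KP Ubb'|Ubb']; last apply/KP; by apply/(UE _ _ (psiB b b')).
have [n _ nE] : exists2 n, (n <= m * size s)%N &
    #|[set: B]%SET : KG|%g = (l ^ n)%N.
  apply/dvdn_pfactor => //; apply: dvdn_trans (dvdn_indexg _ _) _.
  by rewrite cardsT card_mx card_ord lm -expnM mul1n dvdnn.
exists n; rewrite -nE.
pose C (b : B) := [set y | U (y - psi b)].
have CE b b' : C b = C b' <-> U (psi b - psi b').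
  split=> [Cbb'|Ubb'].
    have : C b (psi b) by rewrite /C /= subrr.
    by rewrite Cbb'.
  rewrite /C; apply/seteqP; split=> y /= Uy.
    by rewrite -(subrKA (psi b)); exact: UD.
  by rewrite -(subrKA (psi b')); apply: UD => //; rewrite -opprB; exact: UN.
pose f (j : 'I_#|rcosets KG [set: B]%SET|) := C (repr (enum_val j)).
have fP j : exists2 b, enum_val j = (KG :* b)%g & f j = C b.
  have /rcosetsP[b _ jb] := enum_valP j; exists b => //.
  rewrite /f jb; apply/CE/inK; rewrite -mem_rcoset; exact: mem_repr_rcoset.
have finj : {in [set: 'I_#|rcosets KG [set: B]%SET|] &, injective f}.
  move=> i j _ _; have [b ib ->] := fP i; have [b' jb' ->] := fP j.
  move=> /CE/inK; rewrite -mem_rcoset => /(@rcoset_eqP _ KG) bb'.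
  by apply: enum_val_inj; rewrite ib jb'.
suff -> : cosets U = f @` setT.
  apply: card_eq_trans (inj_card_eq finj) _; apply: card_esym.
  exact: card_II.
apply/seteqP; split=> [_ [x _ <-]|_ [j _ <-]]; last first.
  by have [b _ ->] := fP j; exists (psi b).
have [i Uxi] := sP x.
pose b : B := \row_k if k == i then inZp 1 else 0.
have Uxb : U (x - psi b).
  rewrite -(subrKA s`_i); apply: UD => //.
  (* The remainder covers [m = 0], where the residue of 1 is 0; the dropped multiple of [l ^ m]
     contributes an element of [U]. *)
  have -> : psi b = s`_i *+ (1 %% l ^ m).
    rewrite /psi (bigD1 i) //= big1 => [|k /negbTE ki]; last by rewrite mxE ki.
    by rewrite addr0 mxE eqxx /= lm.
  rewrite -{1}[s`_i]mulr1n {1}(divn_eq 1 (l ^ m)) mulrnDr addrK mulnC mulrnA.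
  exact: open_subgroupMn.
have Kb : (KG :* b)%g \in rcosets KG [set: B]%SET.
  by apply/rcosetsP; exists b; rewrite ?inE.
exists (enum_rank_in Kb (KG :* b)%g) => //; rewrite /f enum_rankK_in //.
have -> : C (repr (KG :* b)%g) = C b.
  by apply/CE/inK; rewrite -mem_rcoset; exact: mem_repr_rcoset.
rewrite /C; apply/seteqP; split=> y /= Uy.
  by rewrite -(subrKA (psi b)); apply: UD => //; rewrite -opprB; exact: UN.
by rewrite -(subrKA x); exact: UD.
Qed.

(** * The extension attached to a family of elements *)

(** Digits of an element with respect to cyclic generators, taken below [l ^ cexp j]; the last field
    expresses their uniqueness. *)
Record coordinates (l : nat) (A : zmodType) (r : nat) := Coordinates {
  cexp : 'I_r -> nat;
  cgen : 'I_r -> A;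
  digit : A -> 'I_r -> nat;
  cexp_gt0 : forall j, (0 < cexp j)%N;
  cgenMn : forall j, cgen j *+ l ^ cexp j = 0;
  digit_lt : forall a j, (digit a j < l ^ cexp j)%N;
  digit_sum : forall a, \sum_j cgen j *+ digit a j = a;
  digit_of_sum : forall (n : 'I_r -> nat) j,
    digit (\sum_i cgen i *+ n i) j = (n j %% l ^ cexp j)%N }.

Lemma coordinates_exist (l : nat) (A : finZmodType) :
  prime l -> l.-nat #|A| -> exists r, inhabited (coordinates l A r).
Proof.
move=> lP lA.
have [r [e [g [e0 gMn gen ind]]]] := abelian_group_coordinates lP lA.
exists r; have /choice[n nE] := gen.
have q0 j : (0 < l ^ e j)%N by rewrite expn_gt0 prime_gt0.
have mod_sum (m : 'I_r -> nat) :
    \sum_j g j *+ (m j %% l ^ e j) = \sum_j g j *+ m j.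
  apply: eq_bigr => j _; rewrite {2}(divn_eq (m j) (l ^ e j)) mulrnDr mulnC.
  by rewrite mulrnA gMn mul0rn add0r.
have inj (m m' : 'I_r -> nat) : \sum_j g j *+ m j = \sum_j g j *+ m' j ->
    forall j, (m j = m' j %[mod l ^ e j])%N.
  move=> mm' j.
  (* Coefficients being natural numbers, [- m' j] is represented by [l ^ e j * m' j - m' j]. *)
  have : \sum_j g j *+ (m j + (l ^ e j * m' j - m' j)) = 0.
    rewrite -[RHS](subrr (\sum_j g j *+ m' j)) -{1}mm' -sumrB.
    apply: eq_bigr => i _; rewrite mulrnDr mulrnBr ?leq_pmull ?q0 //.
    by rewrite mulrnA gMn mul0rn sub0r.
  move=> /ind/(_ j) dv.
  have m'q : (m' j <= l ^ e j * m' j)%N by rewrite leq_pmull.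
  apply/eqP; rewrite -(eqn_modDr (l ^ e j * m' j - m' j)) subnKC //.
  by rewrite modnMr.
have mod_lt (a : A) j : (n a j %% l ^ e j < l ^ e j)%N by rewrite ltn_mod.
have sum_mod (a : A) : \sum_j g j *+ (n a j %% l ^ e j) = a.
  by rewrite mod_sum -nE.
constructor; exists e g (fun a j => n a j %% l ^ e j)%N => // m j.
by apply: inj; rewrite -nE.
Qed.

Section Coordinates.
Variables (l : nat) (lP : prime l) (A : zmodType) (r : nat).
Variable (co : coordinates l A r).
Local Notation q j := (l ^ cexp co j)%N.
Local Notation dig := (digit co).

Let q_gt0 j : (0 < q j)%N. Proof. by rewrite expn_gt0 prime_gt0. Qed.

Lemma digit0 j : dig 0 j = 0%N.
Proof.
by have := digit_of_sum co (fun=> 0%N) j; rewrite mod0n big1.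
Qed.

Lemma digitD a b j : dig (a + b) j = ((dig a j + dig b j) %% q j)%N.
Proof.
rewrite -{1}(digit_sum co a) -{1}(digit_sum co b) -big_split /=.
rewrite -(digit_of_sum co (fun j => dig a j + dig b j)%N).
by congr (digit co _ j); apply: eq_bigr => i _; rewrite mulrnDr.
Qed.

Definition carry a b j := ((dig a j + dig b j) %/ q j)%N.

Lemma carryE a b j : (carry a b j * q j + dig (a + b) j = dig a j + dig b j)%N.
Proof. by rewrite digitD -divn_eq. Qed.

Section FactorSet.
Variable t : 'I_r -> Tl l.

(* The cocycle of the extension generated by [Tl l] and lifts [d j] of the
   generators subject to [d j *+ l ^ cexp co j = t j], when the pair [(x, a)]
   stands for [x + \sum_j d j *+ digit co a j]. *)
Definition carry_sum a b : Tl l := \sum_j t j *+ carry a b j.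

Lemma carry_sum_sym a b : carry_sum a b = carry_sum b a.
Proof. by apply: eq_bigr => j _; rewrite /carry addnC. Qed.

Lemma carry_sum0 a : carry_sum 0 a = 0.
Proof.
apply: big1 => j _.
by rewrite /carry digit0 add0n divn_small ?digit_lt.
Qed.

(** Multiplied by [q j], either total carry equals the sum of the three digits minus the digit of
    [a + b + c]. *)
Lemma carry_sum_assoc a b c :
  carry_sum b c + carry_sum a (b + c) = carry_sum a b + carry_sum (a + b) c.
Proof.
rewrite /carry_sum -!big_split; apply: eq_bigr => j _ /=.
rewrite -!mulrnDr; congr (_ *+ _); apply/eqP.
rewrite -(eqn_pmul2r (q_gt0 j)) !mulnDl; apply/eqP.
apply: (@addIn (dig (a + b + c) j)).
have := carryE a b j; have := carryE (a + b) c j; have := carryE b c j.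
have := carryE a (b + c) j; rewrite addrA.
move: (carry a (b + c) j * _)%N (carry b c j * _)%N (carry (a + b) c j * _)%N
  (carry a b j * _)%N => p1 p2 p3 p4.
by move: (dig _ j) (dig _ j) (dig _ j) (dig _ j) (dig _ j) (dig _ j); lia.
Qed.

Definition carry_factor_set :=
  FactorSet carry_sum_sym carry_sum0 carry_sum_assoc.
End FactorSet.

End Coordinates.

Definition std_gens (l r : nat) (j : 'I_r) : Tl l :=
  fun k => inZp (k %% r == j)%N.

Lemma std_gens_independent (l r : nat) : prime l -> independent (@std_gens l r).
Proof.
move=> lP c c0 n.
have [j cj] : exists j, c 0 j != 0.
  apply: contrapT => nc; case/eqP: c0; apply/rowP => j; rewrite mxE.
  by apply/eqP; apply: contrapT => /negP cj; apply: nc; exists j.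
have rj := ltn_ord j; have r0 : (0 < r)%N by apply: leq_ltn_trans rj.
(* This coordinate is congruent to [j] modulo [r], so the form takes the value [c 0 j] there; the
   factor [n.+1] makes it positive and at least [n]. *)
exists (n.+1 * r + j)%N; first by nia.
have k0 : (0 < n.+1 * r + j)%N by nia.
rewrite (bigD1 j) //= big1 => [|i ij].
  rewrite addr0 /red /std_gens val_Zl // red_mod //.
  by rewrite modnMDl modn_small // eqxx mulr1.
rewrite /red /std_gens val_Zl // red_mod // modnMDl modn_small //.
by rewrite eq_sym -[_ == _]/(i == j) (negbTE ij) mulr0.
Qed.

(** * The model extension and its properties *)

Section Existence.
Variables (l : nat) (lP : prime l) (A : finZmodType) (r : nat).
Variable (co : coordinates l A r).

Definition std_extension : topologicalZmodType :=
  twisted_sum (carry_factor_set lP co (@std_gens l r)).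
Local Notation D := std_extension.
Local Notation q j := (l ^ cexp co j)%N.

Lemma std_extensionMn_snd (u : D) n : (u *+ n).2 = (u.2 : A) *+ n.
Proof. by elim: n => [|n IH] //; rewrite !mulrS twD /= IH. Qed.

Lemma std_extension_inMn (x : Tl l) n : ((x, 0) : D) *+ n = (x *+ n, 0).
Proof.
elim: n => [|n IH] //; rewrite !mulrS IH twD /=.
congr pair; last by rewrite addr0.
by rewrite carry_sum0 addr0.
Qed.

(* For k = j mod r, the map Phi below is a homomorphism to Z/l^k, and modulo
   l^(e_j) it is the j-th digit; for k large, it vanishes modulo l^(e_j) on a
   given torsion element. *)
Lemma std_extension_torsion (u : D) : torsion u -> u.2 = 0.
Proof.
case=> N [N0 uN0]; rewrite -[LHS](digit_sum co) -[RHS](digit_sum co).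
apply: eq_bigr => j _; rewrite digit0; congr (_ *+ _).
have rj := ltn_ord j; have r0 : (0 < r)%N by apply: leq_ltn_trans rj.
(* Since [k > m], divisibility of [z * N] by [l ^ k] leaves at least [cexp co j] factors [l] in
   [z]. *)
set m := (cexp co j + logn l N)%N; pose k := (m.+1 * r + j)%N.
have km : (m < k)%N by rewrite /k; nia.
pose Phi (v : D) : Zl l k :=
  (v.1 k : Zl l k) *+ q j + inZp 1 *+ digit co v.2 j.
(* A carry at digit [j] adds [std_gens j], whose coordinate [k] is 1, and the factor [q j] makes up
   for what the digit loses; the other generators are 0 there. *)
have PhiD v w : Phi (v + w) = Phi v + Phi w.
  rewrite /Phi twD /= !TlD -addrACA -mulrnDr -carryE mulrnDr addrA.
  rewrite !mulrnDl; congr (_ + _ + _).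
  rewrite /carry_sum Tl_sum (bigD1 j) //= big1.
    rewrite addr0 TlMn mulrnA; congr (_ *+ _ *+ _).
    by rewrite /std_gens /k modnMDl modn_small // eqxx.
  move=> i /negbTE ij; rewrite TlMn /std_gens /k modnMDl modn_small // eq_sym.
  rewrite [_ == _]ij -[RHS](mul0rn _ (carry co v.2 w.2 i)); congr (_ *+ _).
  by apply: val_inj; rewrite val_Zl // mod0n.
have Phi0 : Phi 0 = 0.
  by apply: (@addrI _ (Phi 0)); rewrite -PhiD !addr0.
have : Phi u *+ N = 0.
  rewrite -Phi0 -uN0; elim: (N) => [|n IH]; first by rewrite !mulr0n.
  by rewrite !mulrS PhiD IH.
set z := (u.1 k * q j + digit co u.2 j)%N.
have -> : Phi u = inZp z.
  apply: val_inj; rewrite Zl_valD // !Zl_valMn // !val_Zl //.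
  by rewrite modnMml mul1n modnDm.
move=> /(congr1 val); rewrite Zl_valMn // val_Zl // modnMml => zN.
have [z0|z0] := posnP z; first by move: z0; rewrite /z; lia.
have : (l ^ k %| z * N)%N by apply/eqP.
rewrite pfactor_dvdn ?muln_gt0 ?z0 // lognM // => kz.
have : (q j %| z)%N by rewrite pfactor_dvdn //; rewrite /m in km; lia.
rewrite /z dvdn_addr ?dvdn_mull // => /dvdn_leq; have := digit_lt co u.2 j.
by case: (digit co u.2 j) => // d lt /(_ isT); rewrite leqNgt lt.
Qed.

Lemma std_extension_good : good_extension l A D.
Proof.
have clK : closed [set u : D | u.2 = 0].
  by have [] := @finitely_determined_clopen _ _ _ [set u : D | u.2 = 0] 0%N.
have rangeE : range (fun x : Tl l => ((x, 0) : D)) = [set u : D | u.2 = 0].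
  by apply/seteqP; split=> [_ [x _ <-] //|[x a] /= ->]; exists x.
exists (fun x => (x, 0)), (fun u => u.2); split; last split; last split.
- split.
  + move=> x y; rewrite twN twD /=; congr pair; last by rewrite oppr0 addr0.
    by rewrite oppr0 !carry_sum0 subr0 addr0.
  + move=> x U /nbhs_twP[K KU]; apply/nbhs_TlP; exists K => y; exact: KU.
  + by move=> x y [].
- split=> //.
  + move=> u U /principal_filterP Uu; apply/nbhs_twP.
    by exists 0%N => y _; exact: Uu.
  + by move=> a; exists (0, a).
- exact: rangeE.
- rewrite rangeE; apply/seteqP; split.
    apply: subset_trans (clK); apply: closureS => u.
    exact: std_extension_torsion.
  move=> [x a] /= -> U /nbhs_twP[K KU].
  (* Truncating [x] at [K] gives a torsion element, killed by [l ^ K], as close to [x] as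
     required. *)
  pose y : Tl l := fun k => if (k < K)%N then x k else 0 : Zl l k.
  exists (y, 0); split; last by apply: KU => k kK; rewrite /y kK.
  exists (l ^ K)%N; split; first by rewrite expn_gt0 prime_gt0.
  rewrite std_extension_inMn; congr pair.
  apply: functional_extensionality_dep => k.
  rewrite TlMn Tl0 /y; case: ltnP => kK; last by rewrite mul0rn.
  by rewrite -(subnKC (ltnW kK)) expnD mulrnA Zl_char // mul0rn.
Qed.

Lemma std_extension_pro_l : l.-nat #|A| -> pro_l_abelian l D.
Proof.
move=> lA; split.
- exact: tw_hausdorff.
- exact: tw_compact.
- exact/zero_dimension_totally_disconnected/tw_zero_dimensional.
move=> U oU; apply: open_subgroup_index => //; first exact: tw_compact.
move=> u; have [oU' U0 _] := oU.
have /nbhs_twP[K KU] : nbhs (0 : D) U by apply: open_nbhs_nbhs.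
(* [l ^ E] kills the component in [A]; a further [l ^ K] kills the first [K] coordinates, which puts
   the multiple in [U]. *)
pose E := logn l #|A|.
have uE : (u *+ l ^ E).2 = 0.
  rewrite std_extensionMn_snd -p_part part_pnat_id //.
  have := expg_cardG (finset.in_setT (u.2 : A)); rewrite cardsT; exact.
exists (E + K)%N; rewrite expnD mulrnA.
case: (u *+ l ^ E) uE => y a /= ->.
rewrite std_extension_inMn; apply: KU => k kK.
by rewrite TlMn -(subnKC (ltnW kK)) expnD mulrnA Zl_char // mul0rn.
Qed.

End Existence.

(** * Uniqueness *)

(** Closed sets of [S] are compact, so their images under [f] are compact, hence closed in the
    Hausdorff space [T]. *)
Lemma continuous_bijection_homeo (S T : topologicalType)
    (f : S -> T) (g : T -> S) :
  compact [set: S] -> hausdorff_space T -> continuous f ->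
  cancel f g -> cancel g f -> continuous g.
Proof.
move=> cS hT fc fK gK; apply/continuous_closedP => C clC.
have -> : g @^-1` C = f @` C.
  apply/seteqP; split=> [y Cgy|_ [x Cx <-]]; last by rewrite /= fK.
  by exists (g y).
apply: compact_closed => //; apply: continuous_compact.
  exact: continuous_subspaceT.
exact: subclosed_compact clC cS _.
Qed.

Section Uniqueness.
Variables (l : nat) (lP : prime l) (A : finZmodType) (r : nat).
Variable (co : coordinates l A r).
Variables (D' : topologicalZmodType) (hD' : hausdorff_space D').
Local Notation q j := (l ^ cexp co j)%N.
Local Notation dig := (digit co).
Variables (i : {additive Tl l -> D'}) (p : {additive D' -> A}).
Hypotheses (ic : continuous i) (i_inj : injective i).
Hypothesis exact_ip : range i = [set x | p x = 0].
Hypothesis torsion_i : closure (@torsion D') `<=` range i.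

Let pi0 x : p (i x) = 0.
Proof. by have : range i (i x) by []; rewrite exact_ip. Qed.

Variables (d : 'I_r -> D') (t : 'I_r -> Tl l).
Hypothesis pd : forall j, p (d j) = cgen co j.
Hypothesis it : forall j, i (t j) = d j *+ q j.

(* A combination x of the t_j that vanishes mod l on all coordinates k > n is
   l s up to torsion; dividing x - l s by l inside D' then gives a torsion
   element w that does not come from Tl l. *)
Lemma lifts_independent : independent t.
Proof.
move=> c c0 n; apply: contrapT => nt.
have vanish k : (n <= k)%N -> \sum_j c 0 j * red (t j k) = 0.
  by move=> nk; apply/eqP; apply: contrapT => /negP tk; apply: nt; exists k.
pose x : Tl l := \sum_j t j *+ (c 0 j : nat).
have divl k : exists y : Zl l k, (n < k)%N -> x k = y *+ l :> Zl l k.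
  have [kn|nk] := leqP k n; first by exists 0.
  have /(red_eq0 lP)[y xy] : red (x k : Zl l k) = 0.
    rewrite /x Tl_sum red_sum ?(leq_ltn_trans _ nk) //.
    rewrite -[RHS](vanish k (ltnW nk)).
    apply: eq_bigr => j _; rewrite TlMn redMn ?(leq_ltn_trans _ nk) //.
    by rewrite -mulr_natr natr_Zp mulrC.
  by exists y.
(* Beyond [n], [s] is [x] divided by [l]; its coordinates up to [n] are unconstrained, and [l ^ n]
   will kill their effect. *)
pose s : Tl l := fun k => sval (cid (divl k)).
have sP k : (n < k)%N -> x k = (s k : Zl l k) *+ l := svalP (cid (divl k)).
(* With exponents one less than [cexp co j], multiplying by [l] turns the sum into [i x]. *)
pose w := \sum_j d j *+ (c ord0 j * l ^ (cexp co j).-1)%N - i s.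
have wl : w *+ l = i (x - s *+ l).
  rewrite [RHS]raddfB [i (s *+ l)]raddfMn /x raddf_sum.
  rewrite /w mulrnBl -sumrMnl; congr (_ - _).
  apply: eq_bigr => j _; rewrite raddfMn it -!mulrnA; congr (_ *+ _).
  by rewrite -mulnA -expnSr prednK ?cexp_gt0 // mulnC.
have w_tors : torsion w.
  exists (l * l ^ n)%N; split; first by rewrite muln_gt0 expn_gt0 prime_gt0.
  rewrite mulrnA wl -raddfMn -[RHS](raddf0 i); congr (i _).
  apply: functional_extensionality_dep => k; rewrite TlMn TlD TlN TlMn Tl0.
  have [kn|nk] := leqP k n; last by rewrite sP // subrr mul0rn.
  by rewrite -(subnKC kn) expnD mulrnA Zl_char // mul0rn.
have : p w = 0.
  by have := torsion_i (subset_closure w_tors); rewrite exact_ip.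
rewrite raddfB pi0 subr0 raddf_sum.
under eq_bigr do rewrite raddfMn pd.
move=> w0; case/eqP: c0; apply/rowP => j; rewrite mxE.
have := digit_of_sum co (fun j => c ord0 j * l ^ (cexp co j).-1)%N j.
rewrite w0 digit0 // => /esym/eqP.
rewrite -[_ == _]/(l ^ cexp co j %| _)%N -{1}(prednK (cexp_gt0 co j)) expnS.
rewrite dvdn_pmul2r ?expn_gt0 ?prime_gt0 // => lc.
have cl : (c ord0 j < l)%N by rewrite -[X in (_ < X)%N](Fp_cast lP) ltn_ord.
by apply/val_inj/eqP; rewrite -leqn0 leqNgt; apply: contraTN lc => cpos;
  rewrite gtnNdvd.
Qed.

(** The automorphism [f] carries the standard generators to the [t j], so sending [(x, a)] to
    [i (f x)] plus the digit combination of the lifts [d j] turns carries into the relations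
    [it]. *)
Lemma std_extension_iso : topgroup_isomorphic (std_extension lP co) D'.
Proof.
have [f [f' [fD fc fK f'K ftE]]] := independent_automorphism lP
  (std_gens_independent lP) lifts_independent.
pose F (u : std_extension lP co) : D' := i (f u.1) + \sum_j d j *+ dig u.2 j.
have f0 : f 0 = 0 by apply: (@addrI _ (f 0)); rewrite -fD !addr0.
have fMn x n : f (x *+ n) = f x *+ n.
  by elim: n => [|n IH] //; rewrite !mulrS fD IH.
have FD u v : F (u + v) = F u + F v.
  rewrite /F twD /= !fD !raddfD /= addrACA -!addrA; do 2 congr (_ + _).
  rewrite -big_split /= /carry_sum (big_morph f fD f0) raddf_sum -big_split /=.
  apply: eq_bigr => j _; rewrite fMn ftE raddfMn it -mulrnA mulnC.
  by rewrite -!mulrnDr carryE.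
have FB : zmod_morphism F.
  by move=> u v; apply/eqP; rewrite -subr_eq opprK -FD subrK.
have pF u : p (F u) = u.2.
  rewrite raddfD pi0 add0r raddf_sum -[RHS](digit_sum co).
  by apply: eq_bigr => j _; rewrite raddfMn pd.
have Finj : injective F.
  move=> u v Fuv; have uv2 : u.2 = v.2 by rewrite -!pF Fuv.
  have : i (f u.1) = i (f v.1) by move: Fuv; rewrite /F uv2 => /addIr.
  by move=> /i_inj/(can_inj fK); case: (u) (v) uv2 => x a [y b] /= -> ->.
have Fsurj y : exists u, F u = y.
  have : range i (y - \sum_j d j *+ dig (p y) j).
    rewrite exact_ip /= raddfB raddf_sum -[X in X - _](digit_sum co).
    rewrite -sumrB big1 // => j _.
    by rewrite raddfMn pd subrr.
  case=> x _ xE; exists (f' x, p y).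
  by rewrite /F /= f'K xE subrK.
have [G GK] := choice Fsurj.
have FK : cancel F G by move=> u; apply: Finj; rewrite GK.
have Fc : continuous F.
  move=> u U FuU; apply/nbhs_twP.
  suff /nbhs_TlP[K KU] : nbhs u.1 (fun x => U (F (x, u.2))).
    by exists K => y /KU.
  have : continuous (fun x => F (x, u.2)).
    move=> x; apply: (@continuous_comp _ _ _ f
      (fun y => i y + \sum_j d j *+ dig u.2 j)); first exact: fc.
    apply: (@continuous_comp _ _ _ i
      (fun y => y + \sum_j d j *+ dig u.2 j)); first exact: ic.
    exact: translation_continuous.
  apply; by case: (u) FuU.
exists F, G; split=> //.
apply: (continuous_bijection_homeo _ hD' Fc FK GK); exact: tw_compact.
Qed.

End Uniqueness.

Theorem theorem4 (l : nat) (hl : prime l) (A : finZmodType)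
  (hA : l.-nat #|A|) :
  exists D : topologicalZmodType,
    [/\ pro_l_abelian l D, good_extension l A D &
        forall D' : topologicalZmodType,
          pro_l_abelian l D' -> good_extension l A D' ->
          topgroup_isomorphic D D'].
Proof.
have [r [co]] := coordinates_exist hl hA.
exists (std_extension hl co); split.
- exact: std_extension_pro_l.
- exact: std_extension_good.
move=> D' [hD' _ _ _] [i [p [[iB ic i_inj] [[pB pc p_surj] [ipE clE]]]]].
pose i' : {additive Tl l -> D'} :=
  HB.pack i (GRing.isZmodMorphism.Build _ _ i iB).
pose p' : {additive D' -> A} :=
  HB.pack p (GRing.isZmodMorphism.Build _ _ p pB).
have /choice[d dP] (j : 'I_r) := p_surj (cgen co j).
(* [p] sends this multiple of [d j] to 0, so exactness puts it in the image of [i]. *)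
have /choice[t tP] (j : 'I_r) : exists x, i' x = d j *+ (l ^ cexp co j).
  have : range i (d j *+ (l ^ cexp co j)).
    by rewrite ipE /= -[p]/(p' : _ -> _) raddfMn /= dP cgenMn.
  by case=> x _ xE; exists x.
apply: (@std_extension_iso l hl A r co D' hD' i' p' ic i_inj ipE _ d t dP tP).
by rewrite clE.
Qed.
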